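(* Let $\Omega=\{\omega^1,\dots,\omega^S\}$ be a finite sample space with probabilities $p_1,\dots,p_S$, let $\alpha\in(0,1)$, let $\mathcal{D}\subseteq\mathbb{R}^n$ be convex, and let $f(\cdot,\omega^s):\mathcal{D}\to\mathbb{R}$ for $s=1,\dots,S$. Let $$\mathcal{W}=\Big\{v\in\mathbb{R}^S_+ : \ \frac{-p_s}{1-\alpha}\Big[\sum_{s'=1}^S v_{s'}-1\Big]+v_s\le 0,\ s=1,\dots,S\Big\},$$ and let $\{v^j=(v^j_s)_{s=1}^S\}_{j=1}^J$ be the finite family of extreme points of $\mathcal{W}$. Then for every $x\in\mathcal{D}$, $$\mathrm{VaR}_\alpha(f(x,\tilde\omega))=\mathrm{CVaR}_\alpha(f(x,\tilde\omega))+\max_{1\le j\le J}\ \sum_{s=1}^S\big[f(x,\omega^s)-\mathrm{CVaR}_\alpha(f(x,\tilde\omega))\big]\,v^j_s .$$ Consequently, if $f(\cdot,\omega^s)$ is dc on $\mathcal{D}$ for every $s$, then $x\mapsto \mathrm{VaR}_\alpha(f(x,\tilde\omega))$ is dc on $\mathcal{D}$.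
   Context: A function on a convex set is dc if it is the difference of two real-valued convex functions on that set. $\tilde\omega$ is the random variable taking value $\omega^s$ with probability $p_s$. For a random variable $\mathcal{Z}$ and $\alpha\in(0,1)$, with $[\cdot]_+=\max(0,\cdot)$, $$\mathrm{CVaR}_\alpha(\mathcal{Z})=\min_{t\in\mathbb{R}}\Big[t+\frac{1}{1-\alpha}\mathbb{E}[\mathcal{Z}-t]_+\Big],\qquad \mathrm{VaR}_\alpha(\mathcal{Z})=\min\Big\{t' : t'\in\operatorname*{argmin}_{t\in\mathbb{R}}\Big[t+\frac{1}{1-\alpha}\mathbb{E}[\mathcal{Z}-t]_+\Big]\Big\}.$$ *)

(* Defs.v *)
From HB Require Import structures.
From mathcomp Require Export all_boot all_order all_algebra.
From mathcomp Require Export all_classical all_reals all_analysis.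

Set Implicit Arguments.
Unset Strict Implicit.
Unset Printing Implicit Defensive.

Import Order.TTheory GRing.Theory Num.Theory.

Local Open Scope classical_set_scope.
Local Open Scope ring_scope.
Local Open Scope convex_scope.

Definition is_least {d : Order.disp_t} {T : porderType d} (A : set T) (m : T) :=
  A m /\ lbound A m.

Definition is_greatest {d : Order.disp_t} {T : porderType d} (A : set T)
    (m : T) :=
  A m /\ ubound A m.

Section risk.
Context {d : measure_display} {T : measurableType d} {R : realType}.
Context (P : probability T R) (alpha : R) (Z : T -> R).

(* Extended-real valued: the expectation is +oo when Z^+ is not integrable. *)
Definition cvar_objective (t : R) : \bar R :=
  (t%:E + ((1 - alpha)^-1)%R%:E * 'E_P[fun w => (Num.max 0 (Z w - t))%R])%E.

Definition cvar_argmin : set R :=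
  [set t | forall u, (cvar_objective t <= cvar_objective u)%E].

(* xget picks the unique least element; its default value 0 is only returned
   when no least element exists. *)
Definition CVaR : R := fine (xget 0%E (is_least (range cvar_objective))).

Definition VaR : R := xget 0 (is_least cvar_argmin).

End risk.

(* The functions are total, but only their values on D are constrained. *)
Definition dc_on {R : realType} {E : lmodType R} (D : set (convex_lmodType E))
    (f : E -> R) :=
  exists g h : E -> R, [/\ convex_function D g, convex_function D h &
    forall x, D x -> f x = g x - h x].

Definition extreme_points {R : realType} {E : lmodType R}
    (W : set (convex_lmodType E)) : set (convex_lmodType E) :=
  [set v | W v /\ forall x y (t : {i01 R}), W x -> W y ->
     0 < t%:num < 1 -> v = x <| t |> y -> x = v /\ y = v].

Definition dual_polyhedron {R : realType} {S : nat} (p : 'I_S -> R)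
    (alpha : R) : set 'rV[R]_S :=
  [set v | (forall s, 0 <= v 0 s) /\
     forall s, - p s / (1 - alpha) * (\sum_s' v 0 s' - 1) + v 0 s <= 0].

(* Main.v *)
Require Import Defs.
From mathcomp Require Import ring lra.

Set Implicit Arguments.
Unset Strict Implicit.
Unset Printing Implicit Defensive.

Import Order.TTheory GRing.Theory Num.Theory.

Local Open Scope classical_set_scope.
Local Open Scope ring_scope.

(** Fix x and let q be the lower alpha-quantile of c_s = f(x, omega^s). The
    slopes of phi(t) = t + E[c - t]_+ / (1 - alpha) are negative left of q and
    nonnegative right of q, so VaR = q and CVaR = phi(q) =: C. For v in W, the
    bounds 0 <= v_s <= p_s (sum v - 1) / (1 - alpha) give
      sum (c_s - C) v_s <= sum [c_s - q]_+ v_s + (q - C) sum v <= q - C,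
    with equality at an explicit point of W. That point is extreme because the
    constraints tight at it determine it. In general an extreme point of a
    polyhedron is determined by its set of tight constraints, so there are
    finitely many. Finally VaR is the minimum, over the sets J of scenarios of
    probability at least alpha, of max_(s in J) f(x, omega^s), and dc functions
    are stable under finite maxima and minima. *)

(** * Expectations under a finite law *)

Lemma expectation_finite_law {R : realType} {I : finType}
    {dT dOm : measure_display} {T : measurableType dT} (P : probability T R)
    {Om : measurableType dOm} (measurable_Om : forall A : set Om, measurable A)
    (omega : I -> Om) (omega_bij : bijective omega) (omt : {RV P >-> Om})
    (p : I -> R) (omt_p : forall s, distribution P omt [set omega s] = (p s)%:E)
    (h : Om -> R) : (forall y, 0 <= h y) ->
  ('E_P[fun w => h (omt w)] = (\sum_s p s * h (omega s))%:E)%E.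
Proof.
move=> h0; rewrite unlock.
rewrite -[LHS](@ge0_integral_distribution _ _ _ _ _ P omt (EFin \o h)); last 2 first.
- by move=> mD A mA; exact: measurable_Om.
- by move=> y; rewrite lee_fin.
(* The integral now lives on [Om], which splits into the singletons [[set omega s]]; [h] is constant
   on each of them. *)
have -> : [set: Om] = \big[setU/set0]_(s <- index_enum I) [set omega s].
  apply/seteqP; split=> // y _; have [g _ gK] := omega_bij.
  by rewrite -bigcup_seq /=; exists (g y); rewrite ?gK//= mem_index_enum.
rewrite ge0_integral_bigsetU ?index_enum_uniq //; last 2 first.
- by move=> i j _ _ [y [/= -> /(bij_inj omega_bij)]].
- by move=> y _; rewrite lee_fin.
rewrite -sumEFin; apply: eq_bigr => s _.
rewrite (eq_integral (cst (h (omega s))%:E)); last by move=> y /set_mem ->.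
by rewrite integral_cst // [X in (_ * X)%E]omt_p -EFinM mulrC.
Qed.

(** * Lower quantiles and the Rockafellar-Uryasev objective *)

Section discrete_quantile.
Context {R : realType} {I : finType} (p : I -> R) (alpha : R) (c : I -> R).
Hypotheses (p_ge0 : forall s, 0 <= p s) (p_sum1 : \sum_s p s = 1).
Hypothesis (alpha01 : 0 < alpha < 1).

(** For nonnegative weights the strict second inequality makes [q] the least threshold with
    cumulative mass at least [alpha], hence unique. *)
Definition is_quantile (q : R) :=
  alpha <= \sum_(s | c s <= q) p s /\ \sum_(s | c s < q) p s < alpha.

(** Otherwise [J] would lie inside [c < q], whose mass is below [alpha]. This yields the lower bound
    in the min-max formula for the quantile. *)
Lemma quantile_le q (J : {set I}) : is_quantile q -> alpha <= \sum_(s in J) p s ->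
  exists2 s, s \in J & q <= c s.
Proof.
move=> [_ qlt] leJ; apply/exists_inP; apply: contraLR leJ.
rewrite negb_exists -ltNge => /forallP qJ; apply: le_lt_trans qlt.
rewrite [leLHS]big_mkcond [leRHS]big_mkcond /=; apply: ler_sum => s _.
case: ifPn => sJ; last by case: ifP.
by have := qJ s; rewrite negb_and sJ /= -ltNge => ->.
Qed.

Lemma quantile_exists : exists s, is_quantile (c s).
Proof.
pose good s := alpha <= \sum_(s' | c s' <= c s) p s'.
have [s0 _] : exists s : I, true.
  case: (pickP (xpredT : pred I)) => [s _|I0]; first by exists s.
  by move: p_sum1; rewrite big_pred0 // => /eqP; rewrite eq_sym oner_eq0.
have [smax _ le_smax] := @arg_maxP _ _ _ s0 xpredT c isT.
have good_smax : good smax.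
  rewrite /good (eq_bigl xpredT) ?p_sum1; last by move=> s; exact: le_smax.
  by case/andP: alpha01 => _ /ltW.
have [s good_s le_s] := @arg_minP _ _ _ smax good c good_smax.
exists s; split=> //; rewrite ltNge; apply/negP => le_lt.
have [s1 s1P|no] := pickP [pred s' | c s' < c s]; last first.
  by move: le_lt; rewrite big_pred0 //; case/andP: alpha01 => /lt_geF ->.
(* The largest value below [c s] already accumulates all the mass of [c < c s], so it would be good
   as well, against the minimality of [s]. *)
have [s2 s2lt le_s2] := @arg_maxP _ _ _ s1 [pred s' | c s' < c s] c s1P.
have /le_s : good s2.
  apply: le_trans le_lt _; rewrite [leLHS]big_mkcond [leRHS]big_mkcond /=.
  apply: ler_sum => s3 _; case: ifPn => [s3lt|_]; last by case: ifP.
  by rewrite (le_s2 s3 s3lt : c s3 <= c s2).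
by move: s2lt => /= /lt_geF ->.
Qed.

Definition rockafellar (t : R) :=
  t + (1 - alpha)^-1 * \sum_s p s * Num.max 0 (c s - t).

(** A subgradient inequality at [q]: [b] selects the scenarios where the slope of [[c s - t]_+] is
    taken to be -1 rather than 0. *)
Let gap (b : pred I) (q u : R) :
  (forall s, Num.max 0 (c s - q) - (if b s then u - q else 0)
             <= Num.max 0 (c s - u)) ->
  rockafellar q + (u - q) * (1 - (1 - alpha)^-1 * \sum_(s | b s) p s)
    <= rockafellar u.
Proof.
move=> H; have a1 : 0 <= (1 - alpha)^-1.
  by rewrite invr_ge0 subr_ge0 ltW //; case/andP: alpha01.
have : \sum_s p s * Num.max 0 (c s - q) - (u - q) * \sum_(s | b s) p s
      <= \sum_s p s * Num.max 0 (c s - u).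
  rewrite mulr_sumr [X in _ - X]big_mkcond /= -sumrB.
  apply: ler_sum => s _; apply: le_trans (ler_wpM2l (p_ge0 s) (H s)).
  by case: ifP => _; rewrite mulrBr ?mulr0 // [(u - q) * _]mulrC.
move=> /(ler_wpM2l a1); rewrite /rockafellar; lra.
Qed.

Lemma quantile_tail q :
  \sum_(s | q <= c s) p s = 1 - \sum_(s | c s < q) p s.
Proof.
rewrite -p_sum1 [X in _ = X - _](bigID [pred s | c s < q]) /= addrC addrK.
by apply: eq_bigl => s; rewrite -leNgt.
Qed.

(** With [b] the set [q <= c], the slope is the left derivative [(L - alpha) / (1 - alpha)], where
    [L] is the mass of [c < q]; it is negative. *)
Lemma rockafellar_lt q u : is_quantile q -> u < q ->
  rockafellar q < rockafellar u.
Proof.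
move=> [leq ltq] uq; have a1 : 0 < (1 - alpha)^-1.
  by rewrite invr_gt0 subr_gt0; case/andP: alpha01.
have aK : (1 - alpha)^-1 * (1 - alpha) = 1.
  by rewrite mulVf // gt_eqF // -invr_gt0.
have := @gap [pred s | q <= c s] q u.
rewrite quantile_tail => H; apply: lt_le_trans (H _); last first.
  move=> s /=; case: (leP q (c s)) => ?; rewrite !maxEle.
    by do 2 case: (leP 0 (_ - _)) => ?; lra.
  by do 2 case: (leP 0 (_ - _)) => ?; lra.
rewrite ltrDl nmulr_rgt0 ?subr_lt0 //.
have : (1 - alpha)^-1 * (\sum_(s | c s < q) p s) < (1 - alpha)^-1 * alpha.
  by rewrite ltr_pM2l.
by lra.
Qed.
Lemma rockafellar_min q u : is_quantile q -> rockafellar q <= rockafellar u.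
Proof.
move=> [leq ltq]; have a1 : 0 < (1 - alpha)^-1.
  by rewrite invr_gt0 subr_gt0; case/andP: alpha01.
have aK : (1 - alpha)^-1 * (1 - alpha) = 1.
  by rewrite mulVf // gt_eqF // -invr_gt0.
have [qu|uq] := leP q u.
  (* The strict set [q < c] gives the right derivative, nonnegative because [c <= q] has mass at
     least [alpha]. *)
  have := @gap [pred s | q < c s] q u.
  have -> : \sum_(s | [pred s | q < c s] s) p s = 1 - \sum_(s | c s <= q) p s.
    rewrite -p_sum1 [X in _ = X - _](bigID [pred s | c s <= q]) /= addrC addrK.
    by apply: eq_bigl => s; rewrite -ltNge.
  move=> H; apply: le_trans (H _); last first.
    move=> s /=; case: (ltP q (c s)) => ?; rewrite !maxEle.
      by do 2 case: (leP 0 (_ - _)) => ?; lra.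
    by do 2 case: (leP 0 (_ - _)) => ?; lra.
  rewrite lerDl; apply: mulr_ge0; first by rewrite subr_ge0.
  by nra.
by apply/ltW/rockafellar_lt.
Qed.

End discrete_quantile.

(** * The optimal extreme point of the dual polyhedron *)

Section dual_vertex.
Context {R : realType} {S : nat} (p : 'I_S -> R) (alpha : R) (c : 'I_S -> R).
Hypotheses (p_ge0 : forall s, 0 <= p s) (p_sum1 : \sum_s p s = 1).
Hypothesis (alpha01 : 0 < alpha < 1).
Variable q : R.
Hypothesis (q_quantile : is_quantile p alpha c q).

Local Notation L := (\sum_(s | c s < q) p s).

(* By complementary slackness an optimal v vanishes where c < q and is tight
   where c > q; taking it tight on c = q as well leaves a single candidate. *)
Definition dual_vertex : 'rV[R]_S :=
  \row_s (if q <= c s then p s / (alpha - L) else 0).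

Let L_lt : 0 < alpha - L.
Proof. by rewrite subr_gt0; case: q_quantile. Qed.

Let Lne : alpha - L != 0.
Proof. by rewrite gt_eqF. Qed.

Let ane : 1 - alpha != 0.
Proof. by rewrite gt_eqF // subr_gt0; case/andP: alpha01. Qed.

Let sum_dual_vertex : \sum_s dual_vertex 0 s = (1 - L) / (alpha - L).
Proof.
rewrite -(quantile_tail c p_sum1) mulr_suml [RHS]big_mkcond /=.
by apply: eq_bigr => s _; rewrite mxE.
Qed.

Lemma dual_polyhedronP (v : 'rV[R]_S) : dual_polyhedron p alpha v <->
  forall s, 0 <= v 0 s <= p s / (1 - alpha) * (\sum_s' v 0 s' - 1).
Proof.
split=> [[v_ge0 v_le] s|H].
  by rewrite v_ge0 /=; have := v_le s; rewrite !mulNr [X in X <= 0]addrC subr_le0.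
by split=> s; have /andP[] := H s => // _; rewrite !mulNr [X in X <= 0]addrC subr_le0.
Qed.

Lemma dual_vertex_dual_polyhedron : dual_polyhedron p alpha dual_vertex.
Proof.
apply/dual_polyhedronP => s; rewrite sum_dual_vertex mxE.
have -> : p s / (1 - alpha) * ((1 - L) / (alpha - L) - 1) = p s / (alpha - L).
  by field; rewrite ?Lne ?ane //.
have := divr_ge0 (p_ge0 s) (ltW L_lt).
by case: ifP => _ ->; rewrite lexx.
Qed.

(** Summing the tight constraints leaves one linear equation in the total of [v], solvable since
    [alpha - L] is nonzero; the total then fixes every coordinate. *)
Let dual_vertex_active (v : 'rV[R]_S) :
  (forall s, c s < q -> v 0 s = 0) ->
  (forall s, q <= c s -> v 0 s = p s / (1 - alpha) * (\sum_s' v 0 s' - 1)) ->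
  v = dual_vertex.
Proof.
move=> v0 v1.
have sum_v : \sum_s v 0 s = (1 - L) / (1 - alpha) * (\sum_s v 0 s - 1).
  rewrite -(quantile_tail c p_sum1) !mulr_suml [RHS]big_mkcond /=.
  by apply: eq_bigr => s _; case: leP => [/v1 //|/v0 //].
have {}sum_v : \sum_s v 0 s = (1 - L) / (alpha - L).
  have : (1 - alpha) * \sum_s v 0 s = (1 - L) * (\sum_s v 0 s - 1).
    by rewrite {1}sum_v; field; rewrite ?Lne ?ane //.
  by move=> h; apply: (mulfI Lne); rewrite mulrCA mulfV // mulr1; lra.
apply/rowP => s; rewrite mxE; case: leP => [qs|/v0 //].
rewrite v1 // sum_v; field; rewrite ?Lne ?ane //.
Qed.

(** A constraint tight at a strict convex combination of points of the polyhedron is tight at both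
    of them, so [dual_vertex_active] applies to each. *)
Lemma extreme_dual_vertex : extreme_points (dual_polyhedron p alpha) dual_vertex.
Proof.
split=> [|x y t Wx Wy /andP[t0 t1] vE]; first exact: dual_vertex_dual_polyhedron.
have vs s : dual_vertex 0 s = t%:num * x 0 s + (1 - t%:num) * y 0 s.
  by rewrite vE /conv /= !mxE.
have sum_v : \sum_s dual_vertex 0 s =
    t%:num * (\sum_s x 0 s) + (1 - t%:num) * \sum_s y 0 s.
  by rewrite !mulr_sumr -big_split; apply: eq_bigr => s _; rewrite vs.
have tight0 s : c s < q -> x 0 s = 0 /\ y 0 s = 0.
  move=> sq; have := vs s; rewrite mxE leNgt sq /=.
  have /dual_polyhedronP/(_ s)/andP[x0 _] := Wx.
  have /dual_polyhedronP/(_ s)/andP[y0 _] := Wy.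
  by move=> ?; split; nra.
have tight1 s : q <= c s ->
    x 0 s = p s / (1 - alpha) * (\sum_s' x 0 s' - 1) /\
    y 0 s = p s / (1 - alpha) * (\sum_s' y 0 s' - 1).
  move=> sq; have := vs s.
  have -> : dual_vertex 0 s =
      p s / (1 - alpha) * (\sum_s' dual_vertex 0 s' - 1).
    rewrite sum_dual_vertex mxE sq; field; rewrite ?Lne ?ane //.
  rewrite sum_v.
  have /dual_polyhedronP/(_ s)/andP[_] := Wx.
  have /dual_polyhedronP/(_ s)/andP[_] := Wy.
  set A := p s / _; set X := \sum_s0 x 0 s0; set Y := \sum_s0 y 0 s0.
  by move=> ? ? ?; split; nra.
by split; apply: dual_vertex_active => s sq;
  [case: (tight0 s sq)|case: (tight1 s sq)|case: (tight0 s sq)|case: (tight1 s sq)].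
Qed.

Let C := rockafellar p alpha c q.

Let excess : \sum_s p s * Num.max 0 (c s - q) = (1 - alpha) * (C - q).
Proof. by rewrite /C /rockafellar addrAC subrr add0r mulVKf //; lra. Qed.

Lemma dual_vertex_value : \sum_s (c s - C) * dual_vertex 0 s = q - C.
Proof.
(* Split [c s - C] as [(c s - q) + (q - C)]; the vertex vanishes where [c s < q], so only the
   positive part of [c s - q] is seen. *)
have -> : \sum_s (c s - C) * dual_vertex 0 s =
    (\sum_s p s * Num.max 0 (c s - q)) / (alpha - L)
      + (q - C) * \sum_s dual_vertex 0 s.
  rewrite mulr_suml mulr_sumr -big_split; apply: eq_bigr => s _ /=.
  rewrite mxE; case: leP => qs; last by rewrite max_l; [ring|lra].
  by rewrite max_r; [ring|lra].
rewrite excess sum_dual_vertex; field; rewrite ?Lne ?ane //.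
Qed.

Lemma dual_polyhedron_value_le (v : 'rV[R]_S) : dual_polyhedron p alpha v ->
  \sum_s (c s - C) * v 0 s <= q - C.
Proof.
move=> /dual_polyhedronP Wv.
have le1 : \sum_s (c s - q) * v 0 s <= (C - q) * (\sum_s v 0 s - 1).
  (* Expanding [C - q] as a scaled mean excess attaches to each [[c s - q]_+] the upper bound that
     the polyhedron puts on [v 0 s], so the comparison is termwise. *)
  have -> : (C - q) * (\sum_s v 0 s - 1) = \sum_s Num.max 0 (c s - q) *
      (p s / (1 - alpha) * (\sum_s' v 0 s' - 1)).
    have -> : C - q = (\sum_s p s * Num.max 0 (c s - q)) / (1 - alpha).
      by rewrite excess; field; rewrite ?Lne ?ane //.
    by rewrite !mulr_suml; apply: eq_bigr => s _; ring.
  apply: ler_sum => s _; have /andP[v0 v1] := Wv s.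
  apply: (@le_trans _ _ (Num.max 0 (c s - q) * v 0 s)).
    by rewrite ler_wpM2r // le_max lexx orbT.
  by rewrite ler_wpM2l // le_max lexx.
have -> : \sum_s (c s - C) * v 0 s =
    \sum_s (c s - q) * v 0 s + (q - C) * \sum_s v 0 s.
  by rewrite mulr_sumr -big_split; apply: eq_bigr => s _ /=; ring.
lra.
Qed.

End dual_vertex.

(** * Finiteness of the extreme points *)

Lemma finite_extreme_points {R : realType} {E : lmodType R} {I : finType}
    (l : I -> E -> R) (b : I -> R) :
  (forall i, linear (l i : E -> R^o)) ->
  finite_set (extreme_points [set v : convex_lmodType E | forall i, l i v <= b i]).
Proof.
move=> l_lin; set W := [set v | _].
pose active (v : E) := [set i | l i v == b i]%SET.
suff inj : {in extreme_points W &, injective active}.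
  by rewrite -(eq_finite_set (inj_card_eq inj)); exact: finite_finset.
(* [gap i] is a step length that preserves the slack constraint [i] when moving from [v] away from
   [w]. The added 1 keeps the denominator positive, and the default 1 of the minimum covers the case
   with no slack constraint. *)
move=> v w /set_mem [Wv v_ext] /set_mem [Ww _] eq_act.
pose gap i := (b i - l i v) / (1 + `|l i w - l i v|).
pose e := \big[Num.min/1]_(i | l i v < b i) gap i.
have e_gt0 : 0 < e.
  apply: lt_bigmin => // i lt_b.
  by rewrite divr_gt0 ?subr_gt0 // ltr_pwDl.
pose z : E := v - e *: (w - v).
have lz i : l i z = l i v - e * (l i w - l i v).
  have -> : z = - e *: (- 1 *: v + w) + v.
    by rewrite /z scaleN1r addrC scaleNr [- v + w]addrC.
  by rewrite !l_lin /= /GRing.scale /=; ring.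
(* Constraints tight at [v] are also tight at [w], hence constant along the line through both; slack
   ones survive by the choice of [e]. *)
have Wz : W z.
  move=> i; rewrite lz; have := Wv i; rewrite le_eqVlt => /orP[lvb|lvb].
    have : i \in active w by rewrite -eq_act inE.
    by rewrite inE => /eqP ->; rewrite (eqP lvb) subrr mulr0 subr0.
  have : e <= gap i by exact: bigmin_le_cond.
  rewrite ler_pdivlMr ?ltr_pwDl // => le_gap.
  have : e * - (l i w - l i v) <= e * `|l i w - l i v|.
    by rewrite ler_wpM2l ?(ltW e_gt0) // -normrN ler_norm.
  by lra.
have t_ge0 : 0 <= e / (1 + e) by apply: divr_ge0; lra.
have t_le1 : e / (1 + e) <= 1 by rewrite ler_pdivrMr; lra.
have t01 : 0 < (Itv01 t_ge0 t_le1)%:num < 1.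
  by apply/andP; split => /=; [apply: divr_gt0|rewrite ltr_pdivrMr]; lra.
(* Now [v] lies strictly between [w] and [z], so its extremality forces [w = v]. *)
suff vE : v = e / (1 + e) *: w + (1 - e / (1 + e)) *: z :> E.
  by have [->] := v_ext w z _ Ww Wz t01 vE.
clear eq_act; apply: (@scalerI R E (1 + e)); first lra.
have e1 : (1 + e) * (1 - e / (1 + e)) = 1 by field; lra.
have e2 : (1 + e) * (e / (1 + e)) = e by field; lra.
rewrite [RHS]scalerDr !scalerA e1 e2 scale1r scalerDl scale1r.
by rewrite /z scalerBr [RHS]addrC opprB addrA subrK.
Qed.

Lemma xget_is_least {d : Order.disp_t} {T : porderType d} (x0 : T) (A : set T)
    (m : T) : is_least A m -> xget x0 (is_least A) = m.
Proof.
move=> mP; apply: xget_subset1 => // y z [Ay yle] [Az zle].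
by apply/le_anti/andP; split; [exact: yle|exact: zle].
Qed.

(** * VaR and CVaR of a finitely distributed variable *)

Section finite_risk.
Context {R : realType} {I : finType} {dT dOm : measure_display}.
Context {T : measurableType dT} (P : probability T R).
Context {Om : measurableType dOm} (measurable_Om : forall A : set Om, measurable A).
Context (omega : I -> Om) (omega_bij : bijective omega) (omt : {RV P >-> Om}).
Context (p : I -> R).
Hypothesis omt_p : forall s, distribution P omt [set omega s] = (p s)%:E.
Context (alpha : R) (alpha01 : 0 < alpha < 1) (h : Om -> R).

Let c s := h (omega s).
Let Z w := h (omt w).

Lemma law_ge0 s : 0 <= p s.
Proof. by rewrite -lee_fin -omt_p. Qed.

Lemma law_sum1 : \sum_s p s = 1.
Proof.
(* The total mass is the expectation of the constant 1. *)
apply: EFin_inj; rewrite -(expectation_cst P 1).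
rewrite (@expectation_finite_law _ _ _ _ _ P _ measurable_Om _ omega_bij omt p omt_p (cst 1)) //.
by congr EFin; apply: eq_bigr => s _; rewrite mulr1.
Qed.

Lemma cvar_objectiveE t :
  cvar_objective P alpha Z t = (rockafellar p alpha c t)%:E.
Proof.
rewrite /cvar_objective /rockafellar.
rewrite (@expectation_finite_law _ _ _ _ _ P _ measurable_Om _ omega_bij omt p
  omt_p (fun y => Num.max 0 (h y - t))) //.
by move=> y; rewrite le_max lexx.
Qed.

Variable q : R.
Hypothesis q_quantile : is_quantile p alpha c q.

(** The quantile minimises the objective, and strict decrease to its left excludes any smaller
    minimiser. *)
Lemma VaR_quantile : VaR P alpha Z = q.
Proof.
apply: xget_is_least; split=> [u|u u_min].
  by rewrite !cvar_objectiveE lee_fin (rockafellar_min law_ge0 law_sum1).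
rewrite leNgt; apply/negP => /(rockafellar_lt law_ge0 law_sum1 alpha01 q_quantile).
by apply/negP; rewrite -leNgt -lee_fin -!cvar_objectiveE.
Qed.

Lemma CVaR_quantile : CVaR P alpha Z = rockafellar p alpha c q.
Proof.
rewrite /CVaR (@xget_is_least _ _ _ _ (rockafellar p alpha c q)%:E) //.
split=> [|_ [u _ <-]]; first by exists q => //; rewrite cvar_objectiveE.
by rewrite cvar_objectiveE lee_fin (rockafellar_min law_ge0 law_sum1).
Qed.

End finite_risk.

Lemma finite_extreme_points_dual_polyhedron {R : realType} {S : nat}
    (p : 'I_S -> R) (alpha : R) :
  finite_set (extreme_points (dual_polyhedron p alpha)).
Proof.
(* The polyhedron as [2 * S] half-spaces; the constant term of each mass bound moves into [b]. *)
pose l (i : 'I_S + 'I_S) (v : 'rV[R]_S) : R := match i with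
  | inl s => - v 0 s
  | inr s => - p s / (1 - alpha) * (\sum_s' v 0 s') + v 0 s end.
pose b (i : 'I_S + 'I_S) : R := match i with
  | inl s => 0 | inr s => - p s / (1 - alpha) end.
have -> : dual_polyhedron p alpha =
    [set v : convex_lmodType 'rV[R]_S | forall i, l i v <= b i].
  apply/seteqP; split=> v /=.
    move=> [v0 v1] [] s; rewrite /l /b; first by rewrite oppr_le0.
    by have := v1 s; rewrite mulrBr mulr1; lra.
  move=> H; split=> s; first by have := H (inl s); rewrite /l /b oppr_le0.
  by have := H (inr s); rewrite /l /b mulrBr mulr1; lra.
apply: finite_extreme_points => -[] s a u v; rewrite /l.
  by rewrite !mxE /GRing.scale /=; ring.
rewrite !mxE (eq_bigr (fun s' => a * u 0 s' + v 0 s')); last by move=> s' _; rewrite !mxE.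
by rewrite big_split -mulr_sumr /GRing.scale /=; ring.
Qed.

(** * Stability of dc functions *)

Section dc_on.
Context {R : realType} {E : lmodType R} (D : set (convex_lmodType E)).

Let convex_functionD (g h : E -> R) : convex_function D g ->
  convex_function D h -> convex_function D (g \+ h).
Proof.
move=> cg ch t x y xD yD; have := cg t x y xD yD; have := ch t x y xD yD.
by rewrite !convRE /=; lra.
Qed.

Let convex_function_max (g h : E -> R) : convex_function D g ->
  convex_function D h -> convex_function D (fun x => Num.max (g x) (h x)).
Proof.
move=> cg ch t x y xD yD; have := cg t x y xD yD; have := ch t x y xD yD.
rewrite !convRE /= => le_h le_g.
have t0 : 0 <= t%:num by [].
have t1 : 0 <= 1 - t%:num by rewrite subr_ge0.
rewrite ge_max; apply/andP; split.
  by apply: le_trans le_g _; apply: lerD; rewrite ler_wpM2l // le_max lexx.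
by apply: le_trans le_h _; apply: lerD; rewrite ler_wpM2l // le_max lexx orbT.
Qed.

Lemma eq_dc_on (f g : E -> R) :
  (forall x, D x -> f x = g x) -> dc_on D g -> dc_on D f.
Proof.
by move=> fg [g1 [g2 [cg1 cg2 gE]]]; exists g1, g2; split=> // x Dx; rewrite fg // gE.
Qed.

Lemma dc_onN (f : E -> R) : dc_on D f -> dc_on D (fun x => - f x).
Proof.
by move=> [g [h [cg ch fE]]]; exists h, g; split=> // x Dx; rewrite fE // opprB.
Qed.

Lemma dc_on_max (f1 f2 : E -> R) : dc_on D f1 -> dc_on D f2 ->
  dc_on D (fun x => Num.max (f1 x) (f2 x)).
Proof.
move=> [g1 [h1 [cg1 ch1 f1E]]] [g2 [h2 [cg2 ch2 f2E]]].
(* Adding [h1 + h2] to both branches of the maximum makes each a sum of convex functions. *)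
exists (fun x => Num.max ((g1 \+ h2) x) ((g2 \+ h1) x)), (h1 \+ h2); split.
- by apply: convex_function_max; apply: convex_functionD.
- exact: convex_functionD.
- move=> x Dx; rewrite f1E // f2E //= addr_maxl.
  by congr Num.max; ring.
Qed.

(** Describing [f] as an attained upper bound covers maxima over a set of scenarios and, after
    negation, minima over families of such sets. *)
Lemma dc_on_finite_max {I : finType} (A : pred I) (g : I -> E -> R)
    (f : E -> R) : (forall i, A i -> dc_on D (g i)) ->
  (forall x i, D x -> A i -> g i x <= f x) ->
  (forall x, D x -> exists2 i, A i & f x = g i x) -> dc_on D f.
Proof.
move=> dcg g_le f_ex.
(* The iterated maximum needs a seed [g i0] with [i0] in [A]; a point of [D] supplies one, and on an
   empty [D] everything is vacuous. *)
have [[x0 Dx0]|D0] := pselect (exists x, D x); last first.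
  exists (cst 0), (cst 0); split=> [t x y /set_mem Dx| |x Dx].
  - by case: D0; exists x.
  - by move=> t x y /set_mem Dx; case: D0; exists x.
  - by case: D0; exists x.
have [i0 Ai0 _] := f_ex _ Dx0.
apply: (@eq_dc_on _ (fun x => \big[Num.max/g i0 x]_(i <- index_enum I | A i) g i x)).
  move=> x Dx; apply/le_anti/andP; split.
    by have [i Ai ->] := f_ex _ Dx; exact: le_bigmax_cond.
  by apply: bigmax_le => [|i Ai]; exact: g_le.
elim: (index_enum I) => [|i r IHr].
  by apply: (eq_dc_on _ (dcg _ Ai0)) => x _; rewrite big_nil.
have [Ai|nAi] := boolP (A i).
  by apply: (eq_dc_on _ (dc_on_max (dcg _ Ai) IHr)) => x _; rewrite big_cons Ai.
by apply: (eq_dc_on _ IHr) => x _; rewrite big_cons (negbTE nAi).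
Qed.

Lemma dc_on_finite_min {I : finType} (A : pred I) (g : I -> E -> R)
    (f : E -> R) : (forall i, A i -> dc_on D (g i)) ->
  (forall x i, D x -> A i -> f x <= g i x) ->
  (forall x, D x -> exists2 i, A i & f x = g i x) -> dc_on D f.
Proof.
move=> dcg f_le f_ex; apply: (@eq_dc_on _ (fun x => - (- f x))) => [x _|].
  by rewrite opprK.
apply/dc_onN/(@dc_on_finite_max _ A (fun i x => - g i x)) => [i Ai|x i Dx Ai|x Dx].
- exact/dc_onN/dcg.
- by rewrite lerN2 f_le.
- by have [i Ai ->] := f_ex x Dx; exists i.
Qed.

Lemma dc_on_quantile {I : finType} (p : I -> R) (alpha : R) (f : E -> I -> R)
    (q : E -> R) : (forall s, 0 <= p s) -> 0 < alpha ->
  (forall s, dc_on D (f ^~ s)) ->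
  (forall x, D x -> is_quantile p alpha (f x) (q x)) -> dc_on D q.
Proof.
move=> p_ge0 alpha_gt0 dcf qP.
pose heavy (J : {set I}) := alpha <= \sum_(s in J) p s.
(* The default 0 occurs only for empty [J], which is not heavy since [alpha] is positive. *)
pose M (J : {set I}) x :=
  if [pick s in J] is Some s0 then f x [arg max_(s > s0 in J) f x s]%O else 0.
have MP J x : heavy J -> exists s, [/\ s \in J, M J x = f x s &
    forall s', s' \in J -> f x s' <= M J x].
  rewrite /M; case: pickP => [s0 Js0 _|J0].
    by case: arg_maxP => // s Js s_max; exists s.
  by rewrite /heavy big_pred0 // lt_geF.
apply: (@dc_on_finite_min _ heavy M) => [J hJ|x J Dx hJ|x Dx].
- apply: (@dc_on_finite_max _ (mem J) (fun s x => f x s)) => [//|x s _ Js|x _].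
    by have [s' [_ _]] := MP J x hJ; exact.
  by have [s [Js Ms _]] := MP J x hJ; exists s.
- have [s Js qs] := quantile_le p_ge0 (qP x Dx) hJ.
  by have [_ [_ _ leM]] := MP J x hJ; exact: le_trans (leM s Js).
(* The minimum is attained at this sublevel set: it is heavy by the first half of [is_quantile], its
   maximum is at most [q x] by construction and at least [q x] by [quantile_le]. *)
pose J := [set s | f x s <= q x]%SET.
have hJ : heavy J.
  have [leq _] := qP x Dx; rewrite /heavy.
  by rewrite (eq_bigl (fun s => f x s <= q x)) // => s; rewrite inE.
exists J => //; have [s [Js Ms _]] := MP J x hJ.
have [s' Js' qs'] := quantile_le p_ge0 (qP x Dx) hJ.
have [_ [_ _ leM]] := MP J x hJ.
apply/le_anti/andP; split; first exact: le_trans (leM _ Js').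
by rewrite Ms; move: Js; rewrite inE.
Qed.

End dc_on.

Theorem mainTheorem3 (R : realType) (n S : nat)
    (dT dOm : measure_display) (T : measurableType dT)
    (P : probability T R)
    (Om : measurableType dOm) (measurable_Om : forall A : set Om, measurable A)
    (omega : 'I_S -> Om) (omega_bij : bijective omega)
    (omt : {RV P >-> Om})
    (p : 'I_S -> R)
    (omt_p : forall s, distribution P omt [set omega s] = (p s)%:E)
    (alpha : R) (alpha01 : 0 < alpha < 1)
    (D : set 'rV[R]_n) (D_convex : convex_set D)
    (f : 'rV[R]_n -> Om -> R) :
  let VaRf x := VaR P alpha (fun w => f x (omt w)) in
  let CVaRf x := CVaR P alpha (fun w => f x (omt w)) in
  let V := extreme_points (dual_polyhedron p alpha) in
  [/\ finite_set V,
      forall x, D x ->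
        exists2 m : R,
          is_greatest
            [set \sum_s (f x (omega s) - CVaRf x) * v 0 s | v in V] m &
          VaRf x = CVaRf x + m &
      (forall s, dc_on D (fun x => f x (omega s))) -> dc_on D VaRf].
Proof.
move=> VaRf CVaRf V.
have p_ge0 := law_ge0 omt_p.
have p_sum1 := law_sum1 measurable_Om omega_bij omt_p.
have VaR_quant x : is_quantile p alpha (fun s => f x (omega s)) (VaRf x).
  have [s qs] := quantile_exists (fun s => f x (omega s)) p_ge0 p_sum1 alpha01.
  by rewrite /VaRf (VaR_quantile measurable_Om omega_bij omt_p alpha01 qs).
have CVaR_quant x : CVaRf x =
    rockafellar p alpha (fun s => f x (omega s)) (VaRf x).
  by rewrite /CVaRf (CVaR_quantile measurable_Om omega_bij omt_p alpha01
    (VaR_quant x)).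
split; first exact: finite_extreme_points_dual_polyhedron.
- move=> x _; exists (VaRf x - CVaRf x); last by rewrite addrC subrK.
  rewrite CVaR_quant; split.
    exists (dual_vertex p alpha (fun s => f x (omega s)) (VaRf x)).
      exact: extreme_dual_vertex.
    exact: dual_vertex_value.
  (* The upper bound holds on the whole polyhedron, hence at its extreme points. *)
  by move=> _ [v [Wv _] <-]; exact: dual_polyhedron_value_le.
- move=> dcf; case/andP: alpha01 => alpha_gt0 _.
  exact: (@dc_on_quantile _ _ _ _ p alpha (fun x s => f x (omega s))).
Qed.
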